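(* Let $a,b,c$ (in the first identity) and $a,b,c,d,e,f$ (in the second identity) be natural numbers forming admissible colorings of the $\Theta$ graph and of the tetrahedron graph, respectively. Then $$\lim_{N\to\infty}\widehat\Theta(a+2N,b+2N,c+2N)=\frac{1}{1-q}\,\frac{1}{(q;q)_\infty^2},$$ $$\lim_{N\to\infty}\widehat{\mathrm{Tet}}\begin{pmatrix}a+2N&b+2N&e+2N\\ d+2N&c+2N&f+2N\end{pmatrix}=(-q^{-\frac12})^{\nu(S_1^*,S_2^*,S_3^* )}\,\frac{1}{(1-q)(q;q)_\infty^4}\,J^{\mathrm{FKB}}_\Delta(S_1^*,S_2^*,S_3^* ),$$ where $$S_1=\tfrac12(a+d+b+c),\quad S_2=\tfrac12(a+d+e+f),\quad S_3=\tfrac12(b+c+e+f),$$ $S^*=\min\{S_1,S_2,S_3\}$ and $S_i^*=S_i-S^*$ for $i=1,2,3$.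
   Context: Limits are coefficientwise limits of formal power series in $q$. Notation: $(q;q)_n=\prod_{j=1}^n(1-q^j)$ for $n\ge0$, $(q;q)_\infty=\prod_{j\ge1}(1-q^j)$, and $1/(q;q)_n=0$ for $n<0$. Quantum integers and factorials: $[n]=\frac{q^{n/2}-q^{-n/2}}{q^{1/2}-q^{-1/2}}$, $[n]!=\prod_{k=1}^n[k]$, $[0]!=1$. For natural numbers $a_1,\dots,a_r$ with $a_1+\dots+a_r=a$ the quantum multinomial coefficient is $\left[{a\atop a_1,\dots,a_r}\right]=\frac{[a]!}{[a_1]!\cdots[a_r]!}$. A triple of natural numbers is admissible if its sum is even and it satisfies the triangle inequalities. A coloring $(a,b,c)$ of the $\Theta$ graph is admissible if the triple is admissible. A coloring $(a,b,c,d,e,f)$ of the tetrahedron graph is admissible if $(a,b,e),(a,c,f),(c,d,e),(b,d,f)$ are all admissible. Define $$\Theta(a,b,c)=(-1)^{\frac{a+b+c}2}\left[\tfrac{a+b+c}{2}+1\right]\left[{\frac{a+b+c}2\atop\frac{-a+b+c}2,\ \frac{a-b+c}2,\ \frac{a+b-c}2}\right],$$ $$\mathrm{Tet}\begin{pmatrix}a&b&e\\ d&c&f\end{pmatrix}=\sum_{k=T^+}^{S^*}(-1)^k[k+1]\left[{k\atop S_1-k,\ S_2-k,\ S_3-k,\ k-T_1,\ k-T_2,\ k-T_3,\ k-T_4}\right],$$ where $S_1,S_2,S_3,S^*$ are as defined in the claim, $T_1=\frac12(a+b+e)$, $T_2=\frac12(a+c+f)$, $T_3=\frac12(c+d+e)$,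 $T_4=\frac12(b+d+f)$ and $T^+=\max\{T_1,T_2,T_3,T_4\}$. For a nonzero Laurent series $f$ in $q^{1/2}$ with lowest-order monomial $\mathrm{lt}(f)\,q^{\delta(f)}$, where $\mathrm{lt}(f)$ is the coefficient, the shifted series is $\widehat f(q)=\mathrm{lt}(f)^{-1}q^{-\delta(f)}f(q)$. $\widehat\Theta$ and $\widehat{\mathrm{Tet}}$ are the shifted versions of $\Theta$ and $\mathrm{Tet}$ (expanded as Laurent series at $q=0$). For integers $a,b,c$: $$J^{\mathrm{FKB}}_\Delta(a,b,c)=(q;q)_\infty\sum_{n\in\mathbb Z}(-1)^n\frac{q^{\frac12n(3n+1)+n(a+b+c)+\frac12(ab+bc+ca)}}{(q;q)_{n+a}(q;q)_{n+b}(q;q)_{n+c}},$$ $$\nu(a,b,c)=a^*b^*+a^*c^*+b^*c^*-\min\{a,b,c\},$$ where, in this formula for $\nu$, $x^*=x-\min\{a,b,c\}$ for $x\in\{a,b,c\}$.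
   Formalization: The second identity is proved with q^{-ν/2} in place of (-q^{-1/2})^ν: as printed it has the wrong sign when ν is odd, e.g. a=b=c=d=e=2, f=4 gives ν=1, where the left side has leading coefficient 1 and the right side -1. *)

(* Defs.v *)
From HB Require Import structures.
From mathcomp Require Import all_boot all_order all_algebra.
From mathcomp Require Import boolp classical_sets.
From mathcomp Require Import zify.
Set Implicit Arguments.
Unset Strict Implicit.
Unset Printing Implicit Defensive.
Import Order.TTheory GRing.Theory Num.Theory.
Local Open Scope ring_scope.

Section PowerSeries.
Variable K : fieldType.
Implicit Types p r s : nat -> K.

Definition ps_mul p r (n : nat) : K := \sum_(i < n.+1) p i * r (n - i)%N.

(* 'X^k * p *)
Definition ps_pad (k : nat) p (n : nat) : K :=
  if (n < k)%N then 0 else p (n - k)%N.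

Definition ps_trunc (N : nat) p : {poly K} := \poly_(i < N) p i.

Fixpoint ps_inv_seq p (n : nat) : seq K :=
  if n is m.+1 then
    let t := ps_inv_seq p m in
    rcons t (- (p 0%N)^-1 * \sum_(i < m.+1) p i.+1 * t`_(m - i))
  else [:: (p 0%N)^-1].

(* For p 0 != 0, the coefficients of 1 / p. *)
Definition ps_inv p (n : nat) : K := (ps_inv_seq p n)`_n.

Lemma ps_mul_trunc N p r n :
  (n < N)%N -> ps_mul p r n = (ps_trunc N p * ps_trunc N r)`_n.
Proof.
move=> nN; rewrite coefM; apply: eq_bigr => i _.
by rewrite !coef_poly (leq_ltn_trans (leq_ord i) nN) (leq_ltn_trans (leq_subr _ _) nN).
Qed.

Lemma ps_mulC p r : ps_mul p r = ps_mul r p.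
Proof. by apply/funext => n; rewrite !(@ps_mul_trunc n.+1) // mulrC. Qed.

Lemma ps_mulA p r s : ps_mul p (ps_mul r s) = ps_mul (ps_mul p r) s.
Proof.
apply/funext => n; transitivity
  ((ps_trunc n.+1 p * (ps_trunc n.+1 r * ps_trunc n.+1 s))`_n).
  rewrite coefM; apply: eq_bigr => i _.
  by rewrite coef_poly ltn_ord (@ps_mul_trunc n.+1) // ltnS leq_subr.
rewrite mulrA coefM; apply: eq_bigr => i _.
by rewrite coef_poly ltnS leq_subr (@ps_mul_trunc n.+1).
Qed.

Lemma ps_mulDl p r s :
  ps_mul (fun n => p n + r n) s = (fun n => ps_mul p s n + ps_mul r s n).
Proof.
apply/funext => n; rewrite /ps_mul -big_split /=.
by apply: eq_bigr => i _; rewrite mulrDl.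
Qed.

Lemma ps_mul1 p : ps_mul (fun n => (n == 0%N)%:R) p = p.
Proof.
apply/funext => n; rewrite /ps_mul big_ord_recl big1 /= => [|i _].
  by rewrite mul1r subn0 addr0.
by rewrite mul0r.
Qed.

Lemma ps_pad_mul k p r : ps_mul (ps_pad k p) r = ps_pad k (ps_mul p r).
Proof.
apply/funext => n; rewrite /ps_pad /ps_mul.
case: ltnP => nk.
  by rewrite big1 // => i _; rewrite (leq_ltn_trans (leq_ord i) nk) mul0r.
rewrite -(big_mkord xpredT (fun i => (if (i < k)%N then 0 else p (i - k)%N) * r (n - i)%N)).
rewrite (@big_cat_nat _ _ _ k) ?(leqW nk) //= [X in X + _]big_nat_cond.
rewrite big1 ?add0r => [|i /andP[/andP[_ ->] _]]; last by rewrite mul0r.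
rewrite -{1}[k]add0n big_addn subSn // big_mkord; apply: eq_bigr => i _.
by rewrite ltnNge leq_addl addnK (addnC _ k) subnDA.
Qed.

Lemma ps_pad_pad k l p : ps_pad k (ps_pad l p) = ps_pad (k + l) p.
Proof.
apply/funext => n; rewrite /ps_pad.
case: (ltnP n k) => h1; case: (ltnP n (k + l)) => h2 //; try lia.
all: by case: ltnP => h3; rewrite ?subnDA //; lia.
Qed.

Lemma ps_pad_mul2 k l p r :
  ps_mul (ps_pad k p) (ps_pad l r) = ps_pad (k + l) (ps_mul p r).
Proof. by rewrite ps_pad_mul ps_mulC ps_pad_mul ps_pad_pad ps_mulC. Qed.

Lemma size_ps_inv_seq p n : size (ps_inv_seq p n) = n.+1.
Proof. by elim: n => //= n IH; rewrite size_rcons IH. Qed.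

Lemma nth_ps_inv_seq p n i : (i <= n)%N -> (ps_inv_seq p n)`_i = ps_inv p i.
Proof.
elim: n => [|n IH]; first by rewrite leqn0 => /eqP ->.
rewrite leq_eqVlt => /predU1P[-> //|ltin].
by rewrite /= nth_rcons size_ps_inv_seq ltin IH.
Qed.

Lemma ps_mulV p : p 0%N != 0 -> ps_mul p (ps_inv p) = (fun n => (n == 0%N)%:R).
Proof.
move=> p0; apply/funext => -[|n]; rewrite /ps_mul.
  by rewrite big_ord1 /ps_inv /= mulfV.
rewrite big_ord_recl subn0 {1}/ps_inv /= nth_rcons size_ps_inv_seq ltnn eqxx.
rewrite mulNr mulrN mulrA mulfV // mul1r addrC.
apply/eqP; rewrite subr_eq0; apply/eqP; apply: eq_bigr => i _.
by rewrite /bump /= add1n subSS nth_ps_inv_seq // leq_subr.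
Qed.

End PowerSeries.

Section Laurent.
Variable K : fieldType.

Record laurent := Laurent {
  coef : int -> K;
  coef_bounded : exists m : nat, forall n : int, n < - m%:Z -> coef n = 0
}.

HB.instance Definition _ := gen_eqMixin laurent.
HB.instance Definition _ := gen_choiceMixin laurent.

Implicit Types f g h : laurent.

Lemma laurentP f g : (forall n, coef f n = coef g n) -> f = g.
Proof.
case: f g => [f bf] [g bg] /= /funext fg; move: bg; rewrite -fg => bg.
by congr Laurent; apply: Prop_irrelevance.
Qed.

(* v ^- m * p, where v denotes the indeterminate *)
Definition ls_coef (m : nat) (p : nat -> K) (n : int) : K :=
  if n + m%:Z is Posz k then p k else 0.

Lemma ls_coef_bounded m p :
  exists m' : nat, forall n : int, n < - m'%:Z -> ls_coef m p n = 0.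
Proof.
exists m => n nm; rewrite /ls_coef.
by case E: (n + m%:Z) => [k|k] //; exfalso; lia.
Qed.

Definition ls (m : nat) (p : nat -> K) : laurent := Laurent (ls_coef_bounded m p).

Definition bound f : nat := sval (cid (coef_bounded f)).
Definition part f (k : nat) : K := coef f (k%:Z - (bound f)%:Z).

Lemma lsE f m : (forall n : int, n < - m%:Z -> coef f n = 0) ->
  f = ls m (fun k => coef f (k%:Z - m%:Z)).
Proof.
move=> fm; apply: laurentP => n /=; rewrite /ls_coef.
case E: (n + m%:Z) => [k|k]; first by congr coef; lia.
by apply: fm; lia.
Qed.

Lemma ls_part f : f = ls (bound f) (part f).
Proof. by apply: lsE; rewrite /bound; case: cid. Qed.

Lemma ls_pad m k p : ls (m + k) (ps_pad k p) = ls m p.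
Proof.
apply: laurentP => n /=; rewrite /ls_coef /ps_pad.
case Ea: (n + (m + k)%N%:Z) => [a|a]; case Eb: (n + m%:Z) => [b|b] //;
  try (exfalso; lia).
- by case: ltnP => h; [lia | congr p; lia].
- by case: ltnP => h //; lia.
Qed.

Lemma ls_inj m : injective (ls m).
Proof.
move=> p r /(congr1 coef) E; apply/funext => n.
by have := congr1 (fun c => c (n%:Z - m%:Z)) E; rewrite /= /ls_coef subrK.
Qed.

Definition ladd_coef f g n := coef f n + coef g n.
Lemma ladd_bounded f g :
  exists m : nat, forall n : int, n < - m%:Z -> ladd_coef f g n = 0.
Proof.
case: (coef_bounded f) => a fa; case: (coef_bounded g) => b gb.
by exists (a + b)%N => n nab; rewrite /ladd_coef fa ?gb ?addr0 //; lia.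
Qed.
Definition ladd f g := Laurent (ladd_bounded f g).

Lemma lopp_bounded f :
  exists m : nat, forall n : int, n < - m%:Z -> - coef f n = 0.
Proof. by case: (coef_bounded f) => a fa; exists a => n /fa ->; rewrite oppr0. Qed.
Definition lopp f := Laurent (lopp_bounded f).

Definition lzero := ls 0 (fun=> 0).
Definition lone := ls 0 (fun n => (n == 0%N)%:R).

Definition lmul f g := ls (bound f + bound g) (ps_mul (part f) (part g)).

Lemma lzero_coef n : coef lzero n = 0.
Proof. by rewrite /= /ls_coef; case: (n + _). Qed.

Lemma laddA : associative ladd.
Proof. by move=> f g h; apply: laurentP => n /=; rewrite /ladd_coef /= addrA. Qed.
Lemma laddC : commutative ladd.
Proof. by move=> f g; apply: laurentP => n /=; rewrite /ladd_coef addrC. Qed.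
Lemma ladd0 : left_id lzero ladd.
Proof. by move=> f; apply: laurentP => n; rewrite /= /ladd_coef lzero_coef add0r. Qed.
Lemma laddN : left_inverse lzero lopp ladd.
Proof. by move=> f; apply: laurentP => n; rewrite lzero_coef /= /ladd_coef /= addNr. Qed.

HB.instance Definition _ := GRing.isZmodule.Build laurent laddA laddC ladd0 laddN.

Lemma ls_mul a b p r : lmul (ls a p) (ls b r) = ls (a + b) (ps_mul p r).
Proof.
rewrite /lmul; set f := ls a p; set g := ls b r.
have Ef : ps_pad a (part f) = ps_pad (bound f) p.
  by apply: (@ls_inj (bound f + a)); rewrite ls_pad -ls_part addnC ls_pad.
have Eg : ps_pad b (part g) = ps_pad (bound g) r.
  by apply: (@ls_inj (bound g + b)); rewrite ls_pad -ls_part addnC ls_pad.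
by rewrite -(ls_pad _ (a + b)) -ps_pad_mul2 Ef Eg ps_pad_mul2 addnC ls_pad.
Qed.

Lemma lmulC : commutative lmul.
Proof. by move=> f g; rewrite /lmul addnC ps_mulC. Qed.
Lemma lmulA : associative lmul.
Proof.
move=> f g h; rewrite (ls_part f) (ls_part g) (ls_part h) !ls_mul.
by rewrite addnA ps_mulA.
Qed.
Lemma lmul1 : left_id lone lmul.
Proof. by move=> f; rewrite {1}(ls_part f) ls_mul ps_mul1 -ls_part. Qed.

Lemma ls_add a p r : ladd (ls a p) (ls a r) = ls a (fun n => p n + r n).
Proof.
apply: laurentP => n /=; rewrite /ladd_coef /= /ls_coef.
by case: (n + _); rewrite ?addr0.
Qed.

Lemma lmulDl : left_distributive lmul ladd.
Proof.
move=> f g h; rewrite (ls_part f) (ls_part g) (ls_part h).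
rewrite -(ls_pad (bound f) (bound g)) -(ls_pad (bound g) (bound f)).
by rewrite [(bound g + _)%N]addnC ls_add !ls_mul ps_mulDl ls_add.
Qed.

Lemma lone_neq0 : lone != lzero.
Proof.
apply/eqP => /(congr1 (fun f => coef f 0)) /= /eqP.
by rewrite /ls_coef /= oner_eq0.
Qed.

HB.instance Definition _ :=
  GRing.Zmodule_isComNzRing.Build laurent lmulA lmulC lmul1 lmulDl lone_neq0.

Lemma coefD f g n : coef (f + g) n = coef f n + coef g n.
Proof. by []. Qed.

Lemma coefN f n : coef (- f) n = - coef f n.
Proof. by []. Qed.

Lemma coef0 n : coef 0 n = 0.
Proof. exact: lzero_coef. Qed.

Lemma coef1 n : coef 1 n = (n == 0)%:R.
Proof.
rewrite /= /ls_coef addr0.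
by case: n => // n; rewrite ?eqz_nat.
Qed.

Lemma coefM f g (a b : nat) :
    (forall n, n < - a%:Z -> coef f n = 0) ->
    (forall n, n < - b%:Z -> coef g n = 0) ->
  forall k : nat, coef (f * g) (k%:Z - (a + b)%N%:Z) =
    \sum_(i < k.+1) coef f (i%:Z - a%:Z) * coef g ((k - i)%N%:Z - b%:Z).
Proof.
move=> fa gb k; rewrite {1}(lsE fa) {1}(lsE gb) [_ * _]ls_mul /= /ls_coef.
by rewrite subrK.
Qed.

(* c * v ^ d *)
Definition lmono_coef (c : K) (d n : int) : K := if n == d then c else 0.
Lemma lmono_bounded c d :
  exists m : nat, forall n : int, n < - m%:Z -> lmono_coef c d n = 0.
Proof.
by exists `|d|%N => n nd; rewrite /lmono_coef; case: eqP => // E; lia.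
Qed.
Definition lmono c d := Laurent (lmono_bounded c d).

Lemma coef_lmono c d n : coef (lmono c d) n = if n == d then c else 0.
Proof. by []. Qed.

Lemma lmono_ls c d (m : nat) : - m%:Z <= d -> exists2 j : nat, m%:Z + d = j%:Z &
  lmono c d = ls m (ps_pad j (fun n => if n == 0%N then c else 0)).
Proof.
move=> md; exists `|(m%:Z + d)%R|%N; first by lia.
apply: laurentP => n /=; rewrite /lmono_coef /ls_coef /ps_pad.
case Ek: (n + m%:Z) => [k|k]; case: eqP => // E; try (exfalso; lia).
- by rewrite ifN ?ifT //; lia.
- by case: ltnP => // h; rewrite ifN //; lia.
Qed.

Definition is_order f (d : int) : Prop :=
  coef f d != 0 /\ forall n, n < d -> coef f n = 0.

Lemma order_ex f : f != 0 -> exists d, is_order f d.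
Proof.
move=> f0; have fk : exists k, part f k != 0.
  apply: contrapT => /forallNP H; case/eqP: f0; apply: laurentP => n.
  rewrite coef0 [f]ls_part /= /ls_coef; case: (n + _) => // k.
  by apply/eqP; have := H k; case: eqP.
case: (ex_minnP fk) => m fm mmin.
exists (m%:Z - (bound f)%:Z); split => // n nm.
rewrite [f]ls_part /= /ls_coef.
case Ej: (n + _) => [j|j] //.
apply/eqP; apply: contraT => /mmin; lia.
Qed.

Lemma is_order_uniq f d d' : is_order f d -> is_order f d' -> d = d'.
Proof.
move=> [fd dmin] [fd' dmin'].
apply/eqP; rewrite eq_le !leNgt; apply/andP; split.
  by apply/negP => /dmin E; rewrite E eqxx in fd'.
by apply/negP => /dmin' E; rewrite E eqxx in fd.
Qed.

(* The exponent of the lowest-order monomial (0 for the zero series). *)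
Definition order f : int := xget 0 [set d | is_order f d].

Lemma orderP f : f != 0 -> is_order f (order f).
Proof. by move=> /order_ex H; apply: (xgetPex 0 H). Qed.

Definition lead f : K := coef f (order f).

Lemma ls_order f : f != 0 ->
  exists a p, p 0%N != 0 /\ f = lmono 1 a * ls 0 p.
Proof.
move=> /orderP [fd dmin]; set d := order f in fd dmin.
exists d, (fun k => coef f (k%:Z + d)); split; first by rewrite add0r.
have [e De ->] := @lmono_ls 1 d `|d|%N ltac:(lia).
have -> : (fun n => if n == 0%N then 1 else 0) = (fun n => (n == 0%N)%:R : K).
  by apply/funext => n; case: eqP.
rewrite [_ * _]ls_mul addn0 ps_pad_mul ps_mul1.
apply: laurentP => n /=.
rewrite /ls_coef /ps_pad.
case Ek: (n + _) => [k|k]; last by apply: dmin; lia.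
by case: ltnP => h; [apply: dmin; lia | congr coef; lia].
Qed.

Lemma lmonoM a b c d : lmono a c * lmono b d = lmono (a * b) (c + d).
Proof.
have [i Hi ->] := @lmono_ls a c `|c|%N ltac:(lia).
have [j Hj ->] := @lmono_ls b d `|d|%N ltac:(lia).
have [k Hk ->] := @lmono_ls (a * b) (c + d) (`|c| + `|d|)%N ltac:(lia).
rewrite [_ * _]ls_mul ps_pad_mul2.
have -> : k = (i + j)%N by lia.
congr ls; congr ps_pad; apply/funext => n; rewrite /ps_mul big_ord_recl big1 /=.
  by rewrite subn0 addr0; case: eqP => // _; rewrite mulr0.
by move=> l _; rewrite mul0r.
Qed.

Lemma lmono1 : lmono 1 0 = 1.
Proof. by apply: laurentP => n; rewrite coef1 /= /lmono_coef; case: eqP. Qed.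

Lemma linv_ex f : exists g, (f != 0 -> g * f = 1) /\ (f = 0 -> g = 0).
Proof.
case: (eqVneq f 0) => [->|f0]; first by exists 0; split=> //; rewrite eqxx.
have [a [p [p0 fE]]] := ls_order f0.
exists (ls 0 (ps_inv p) * lmono 1 (- a)); split=> [_|E]; last by rewrite E eqxx in f0.
rewrite fE mulrA -[_ * _ * lmono 1 a]mulrA lmonoM mul1r addNr lmono1 mulr1.
by rewrite [_ * _]ls_mul addn0 ps_mulC ps_mulV.
Qed.

Definition linv f : laurent := sval (cid (linv_ex f)).

Lemma linvP f : f != 0 -> linv f * f = 1.
Proof. by rewrite /linv; case: cid => g [gP _] /=. Qed.
Lemma linv0 : linv 0 = 0.
Proof. by rewrite /linv; case: cid => g [_ gP] /=; apply: gP. Qed.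

HB.instance Definition _ := GRing.ComNzRing_isField.Build laurent linvP linv0.

Definition shifted f : laurent := lmono (lead f)^-1 (- order f) * f.

(* Coefficientwise limits. *)
Definition lcvg (u : nat -> laurent) (l : laurent) : Prop :=
  forall n : int, exists N0 : nat, forall N : nat,
    (N0 <= N)%N -> coef (u N) n = coef l n.

Lemma lcvg_uniq u l l' : lcvg u l -> lcvg u l' -> l = l'.
Proof.
move=> ul ul'; apply: laurentP => n.
have [N H] := ul n; have [N' H'] := ul' n.
by rewrite -(H (N + N')%N) ?leq_addr // (H' (N + N')%N) // leq_addl.
Qed.

(* The coefficientwise limit when it exists, 0 otherwise. *)
Definition llim (u : nat -> laurent) : laurent := xget 0 [set l | lcvg u l].

Lemma llimE u l : lcvg u l -> llim u = l.
Proof. by move=> ul; apply: xget_unique => // l' ul'; apply: lcvg_uniq ul' ul. Qed.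

(* Sum over all integers, as the limit of the symmetric partial sums. *)
Definition lsumZ (F : int -> laurent) : laurent :=
  llim (fun M => \sum_(i < M.*2.+1) F (i%:Z - M%:Z)).

End Laurent.

(* All series are Laurent series in v = q ^ (1/2): an exponent e of q in the
   formulas is written as the exponent 2 * e of v. *)
Local Notation L := (laurent rat).

Definition v : L := lmono 1 1.
Definition q : L := v ^+ 2.

Definition qpoch (n : nat) : L := \prod_(1 <= j < n.+1) (1 - q ^+ j).
Definition qpoch_inf : L := llim qpoch.
(* 1 / (q; q)_n for an integer n *)
Definition qpochV (n : int) : L := if n is Posz m then (qpoch m)^-1 else 0.

Definition qint (n : nat) : L := (v ^+ n - v ^- n) / (v - v^-1).
Definition qfact (n : nat) : L := \prod_(1 <= k < n.+1) qint k.
(* Only meaningful when sumn s = a. *)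
Definition qmultinomial (a : nat) (s : seq nat) : L :=
  qfact a / \prod_(i <- s) qfact i.

Definition admissible (a b c : nat) : bool :=
  [&& ~~ odd (a + b + c), (a <= b + c)%N, (b <= a + c)%N & (c <= a + b)%N].

Definition admissible_tet (a b c d e f : nat) : bool :=
  [&& admissible a b e, admissible a c f, admissible c d e & admissible b d f].

(* On admissible colorings all halves below are exact, and all natural number
   subtractions are between a number and a smaller or equal one. *)
Definition Theta (a b c : nat) : L :=
  (-1) ^+ (a + b + c)./2 * qint ((a + b + c)./2 + 1) *
  qmultinomial (a + b + c)./2
    [:: (b + c - a)./2; (a + c - b)./2; (a + b - c)./2].

(* The arguments are read off the rows of the matrix (a b e; d c f). *)
Definition Tet (a b e d c f : nat) : L :=
  let S1 := (a + d + b + c)./2 in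
  let S2 := (a + d + e + f)./2 in
  let S3 := (b + c + e + f)./2 in
  let T1 := (a + b + e)./2 in
  let T2 := (a + c + f)./2 in
  let T3 := (c + d + e)./2 in
  let T4 := (b + d + f)./2 in
  let Smin := minn S1 (minn S2 S3) in
  let Tmax := maxn T1 (maxn T2 (maxn T3 T4)) in
  \sum_(Tmax <= k < Smin.+1)
    (-1) ^+ k * qint (k + 1) *
    qmultinomial k
      [:: S1 - k; S2 - k; S3 - k; k - T1; k - T2; k - T3; k - T4]%N.

Definition J_FKB (a b c : int) : L :=
  qpoch_inf *
  lsumZ (fun n : int =>
    (-1) ^ n *
    v ^ (n * (3 * n + 1) + 2 * n * (a + b + c) + (a * b + b * c + c * a)) *
    (qpochV (n + a) * qpochV (n + b) * qpochV (n + c))).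

Definition nu (a b c : int) : int :=
  let m := Num.min a (Num.min b c) in
  (a - m) * (b - m) + (a - m) * (c - m) + (b - m) * (c - m) - m.

(* Main.v *)
(* Writing [m]! = v^(- C(m,2)) (q;q)_m / (1-q)^m, a quantum multinomial becomes a
   monomial times a quotient of q-factorials. Substituting k = S* + 4N - n in
   Tet makes the summand
     (monomial independent of n) * (1-q)^-1 *
       (-1)^n v^(n(3n+1) + 2n(s1+s2+s3)) / ((q;q)_(s1+n) (q;q)_(s2+n) (q;q)_(s3+n)) *
       (q;q)_(S*+4N-n+1) / prod_j (q;q)_(t_j+N-n),   t_j = S* - T_j.
   The factor on the second line does not depend on N, is the summand of J_FKB
   and is O(v^n); the one on the third line is (q;q)_oo^-3 up to O(v^(N-n)).
   So the shifted series agrees with its limit modulo v^N. *)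
From mathcomp Require Import all_boot all_order all_algebra.
From mathcomp Require Import zify ring.
Require Import Defs.
Set Implicit Arguments.
Unset Strict Implicit.
Unset Printing Implicit Defensive.
Import Order.TTheory GRing.Theory Num.Theory.
Local Open Scope ring_scope.

(** * Congruence of Laurent series modulo powers of [v] *)

Section Order.
Variable K : fieldType.
Implicit Types (f g h : laurent K) (m n : nat).

(** Stated on coefficients rather than through [order], whose value at the zero series is a default;
    so the zero series satisfies every bound. [order_ge 0] singles out the power series. *)
Definition order_ge m f : Prop := forall i : int, i < m%:Z -> coef f i = 0.

Definition eqmodv m f g : Prop := order_ge m (f - g).

Lemma order_ge0 m : order_ge m 0.
Proof. by move=> i _; rewrite coef0. Qed.

Lemma order_geN m f : order_ge m f -> order_ge m (- f).
Proof. by move=> fm i im; rewrite coefN fm ?oppr0. Qed.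

Lemma order_geD m f g : order_ge m f -> order_ge m g -> order_ge m (f + g).
Proof. by move=> fm gm i im; rewrite coefD fm ?gm ?addr0. Qed.

Lemma order_ge_leq m n f : (m <= n)%N -> order_ge n f -> order_ge m f.
Proof. by move=> mn fn i im; apply: fn; lia. Qed.

Lemma order_ge_sum m (I : Type) (r : seq I) (P : pred I) (F : I -> laurent K) :
  (forall i, P i -> order_ge m (F i)) -> order_ge m (\sum_(i <- r | P i) F i).
Proof.
move=> Fm; apply: (big_ind (order_ge m)) => //; first exact: order_ge0.
by move=> f g; apply: order_geD.
Qed.

Lemma coefMn f g : order_ge 0 f -> order_ge 0 g -> forall k : nat,
  coef (f * g) k%:Z = \sum_(i < k.+1) coef f i%:Z * coef g (k - i)%N%:Z.
Proof.
move=> f0 g0 k; have := @coefM K f g 0 0.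
rewrite oppr0 => /(_ f0 g0 k); rewrite subr0 => ->.
by apply: eq_bigr => i _; rewrite !subr0.
Qed.

Lemma order_geM m n f g :
  order_ge m f -> order_ge n g -> order_ge (m + n) (f * g).
Proof.
move=> fm gn.
have f0 : order_ge 0 f by apply: order_ge_leq fm.
have g0 : order_ge 0 g by apply: order_ge_leq gn.
move=> [k|k] kmn; last by rewrite (@lsE _ f 0) // (@lsE _ g 0) // [_ * _]ls_mul.
rewrite coefMn // big1 // => i _.
have [im|mi] := ltnP i m; first by rewrite fm ?mul0r //; lia.
by rewrite [coef g _]gn ?mulr0 //; have := ltn_ord i; lia.
Qed.

Lemma order_geMl m f g : order_ge 0 f -> order_ge m g -> order_ge m (f * g).
Proof. exact: order_geM. Qed.

Lemma order_ge1 : order_ge 0 (1 : laurent K).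
Proof. by move=> i i0; rewrite coef1; case: eqP => // E; lia. Qed.

Lemma coef_lmonoM c (d : int) f (n : int) :
  coef (lmono c d * f) n = c * coef f (n - d).
Proof.
have [j Hj ->] := @lmono_ls _ c d `|d|%N ltac:(lia).
have E : forall p, ps_mul (fun i => if i == 0%N then c else 0) p = fun i => c * p i.
  move=> p; apply/boolp.funext => k; rewrite /ps_mul big_ord_recl big1 /=.
    by rewrite subn0 addr0.
  by move=> i _; rewrite mul0r.
rewrite [in LHS](ls_part f) [_ * _]ls_mul ps_pad_mul E [in RHS](ls_part f) /=.
rewrite /ls_coef /ps_pad.
case Ea: (n + _) => [k|k]; case Eb: (n - d + _) => [l|l]; rewrite ?mulr0 //;
  try (exfalso; lia).
- by case: ltnP => h; [lia | congr (_ * part f _); lia].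
- by case: ltnP => h //; lia.
Qed.

Lemma order_ge_lmono c n : order_ge n (lmono c n%:Z : laurent K).
Proof. by move=> i im; rewrite coef_lmono; case: eqP => // E; lia. Qed.

Lemma eqmodv_refl m f : eqmodv m f f.
Proof. by rewrite /eqmodv subrr; apply: order_ge0. Qed.

Lemma eqmodv_leq m n f g : (m <= n)%N -> eqmodv n f g -> eqmodv m f g.
Proof. exact: order_ge_leq. Qed.

Lemma eqmodv_order_ge m f g : eqmodv m f g -> order_ge 0 g -> order_ge 0 f.
Proof.
move=> fg g0; rewrite -(subrK g f); apply: order_geD => //.
exact: order_ge_leq fg.
Qed.

Lemma eqmodv_sym m f g : eqmodv m f g -> eqmodv m g f.
Proof. by move=> fg; rewrite /eqmodv -opprB; apply: order_geN. Qed.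

Lemma eqmodv_trans m f g h : eqmodv m f g -> eqmodv m g h -> eqmodv m f h.
Proof.
by move=> fg gh; rewrite /eqmodv -(subrK g f) -addrA; apply: order_geD.
Qed.

Lemma eqmodvD m f f' g g' :
  eqmodv m f f' -> eqmodv m g g' -> eqmodv m (f + g) (f' + g').
Proof. by move=> ff' gg'; rewrite /eqmodv opprD addrACA; apply: order_geD. Qed.

(** The difference is [g * (f - f') + f' * (g - g')]. The outer factors must be power series, as
    negative powers would lower the modulus; [g] is one because it is congruent to [g']. *)
Lemma eqmodvM m f f' g g' : order_ge 0 f' -> order_ge 0 g' ->
  eqmodv m f f' -> eqmodv m g g' -> eqmodv m (f * g) (f' * g').
Proof.
move=> f'0 g'0 ff' gg'.
have g0 := eqmodv_order_ge gg' g'0.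
have -> : eqmodv m (f * g) (f' * g') =
          order_ge m (g * (f - f') + f' * (g - g')) by rewrite /eqmodv; congr order_ge; ring.
by apply: order_geD; apply: order_geMl.
Qed.

(** * Power series with constant term 1 *)

Definition unitary f := eqmodv 1 f 1.

Lemma unitary_ge0 f : unitary f -> order_ge 0 f.
Proof. by move=> fu; apply: eqmodv_order_ge fu order_ge1. Qed.

Lemma unitary_coef0 f : unitary f -> coef f 0 = 1.
Proof.
move=> /(_ 0 isT); rewrite coefD coefN coef1 eqxx => /eqP.
by rewrite subr_eq0 => /eqP.
Qed.

Lemma unitary_neq0 f : unitary f -> f != 0.
Proof.
move=> /unitary_coef0 f1; apply/eqP => f0; move: f1; rewrite f0 coef0.
by move/esym/eqP; rewrite oner_eq0.
Qed.

Lemma unitary1 : unitary 1. Proof. exact: eqmodv_refl. Qed.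

Lemma unitaryM f g : unitary f -> unitary g -> unitary (f * g).
Proof.
move=> fu gu; rewrite /unitary -[1]mulr1.
by apply: eqmodvM => //; apply: order_ge1.
Qed.

Lemma unitary_prod (I : Type) (r : seq I) (F : I -> laurent K) :
  (forall i, unitary (F i)) -> unitary (\prod_(i <- r) F i).
Proof.
move=> Fu; apply: (big_ind unitary) => //; first exact: unitary1.
exact: unitaryM.
Qed.

Lemma unitaryX f k : unitary f -> unitary (f ^+ k).
Proof.
move=> fu; elim: k => [|k IH]; first by rewrite expr0; apply: unitary1.
by rewrite exprS; apply: unitaryM.
Qed.

(** The field inverse comes from a choice and does not compute, so it is identified with the
    explicit power series [ps_inv] by uniqueness of inverses. *)
Lemma order_geV f : unitary f -> order_ge 0 f^-1.
Proof.
move=> fu; have f0 := unitary_ge0 fu.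
have fE : f = ls 0 (fun k : nat => coef f (k%:Z - 0%N%:Z)) by apply: lsE.
set p := (fun k : nat => _) in fE.
have p0 : p 0%N != 0 by rewrite /p subr0 unitary_coef0 // oner_eq0.
have fV : f * ls 0 (ps_inv p) = 1 by rewrite [X in X * _]fE [_ * _]ls_mul ps_mulV.
suff -> : f^-1 = ls 0 (ps_inv p) by move=> [i|i].
by apply: (mulfI (unitary_neq0 fu)); rewrite fV mulfV // unitary_neq0.
Qed.

(** The difference of the inverses is [- (f - g) / (f * g)], and [1 / (f * g)] is again a power
    series. *)
Lemma eqmodvV m f g : unitary f -> unitary g ->
  eqmodv m f g -> eqmodv m f^-1 g^-1.
Proof.
move=> fu gu fg; have fn0 := unitary_neq0 fu; have gn0 := unitary_neq0 gu.
have -> : eqmodv m f^-1 g^-1 = order_ge m (- (f^-1 * g^-1 * (f - g))).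
  by rewrite /eqmodv; congr order_ge; field; rewrite fn0 gn0.
apply/order_geN/order_geMl => //.
by apply: (@order_geMl 0); apply: order_geV.
Qed.

Lemma unitaryV f : unitary f -> unitary f^-1.
Proof. by move=> fu; rewrite /unitary -invr1; apply: eqmodvV => //; apply: unitary1. Qed.

Lemma eqmodv_prod m (s : seq nat) (F : nat -> laurent K) g : unitary g ->
  (forall i, i \in s -> eqmodv m (F i) g) ->
  eqmodv m (\prod_(i <- s) F i) (g ^+ size s).
Proof.
move=> gu; elim: s => [|i s IH] Fg; first by rewrite big_nil; apply: eqmodv_refl.
rewrite big_cons exprS; apply: eqmodvM; first exact: unitary_ge0.
- exact/unitary_ge0/unitaryX.
- by apply: Fg; rewrite mem_head.
- by apply: IH => j js; apply: Fg; rewrite in_cons js orbT.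
Qed.

(** * Shifted series, limits and bilateral sums *)

(** A shifted series forgets a monomial prefactor, so it suffices to write [Theta] and [Tet] as a
    monomial times a series with constant term 1. *)
Lemma shifted_lmono c d f : c != 0 -> unitary f -> shifted (lmono c d * f) = f.
Proof.
move=> c0 fu; set h := lmono c d * f.
have hd : is_order h d.
  split; first by rewrite coef_lmonoM subrr unitary_coef0 // mulr1.
  by move=> n nd; rewrite coef_lmonoM (unitary_ge0 fu) ?mulr0 //; lia.
have h0 : h != 0.
  by apply/eqP => E; case: hd => /eqP []; rewrite E coef0.
have Eo : order h = d by apply: is_order_uniq (orderP h0) hd.
rewrite /shifted /lead Eo coef_lmonoM subrr unitary_coef0 // mulr1.
by rewrite mulrA lmonoM mulVf // addNr lmono1 mul1r.
Qed.

Lemma eqmodv_lcvg (u : nat -> laurent K) l :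
  (forall N, eqmodv N (u N) l) -> lcvg u l.
Proof.
move=> ul n; exists `|n|.+1 => N nN; have := ul N n ltac:(lia).
by rewrite coefD coefN => /eqP; rewrite subr_eq0 => /eqP.
Qed.

(** Provides the existence of the limit, which [llim] alone does not, together with the rate of
    convergence. *)
Lemma llim_eqmodv (u : nat -> laurent K) : order_ge 0 (u 0%N) ->
  (forall N, eqmodv N (u N.+1) (u N)) -> forall N, eqmodv N (u N) (llim u).
Proof.
move=> u0 uS.
have uD : forall N k, eqmodv N (u (N + k)%N) (u N).
  move=> N; elim=> [|k IH]; first by rewrite addn0; apply: eqmodv_refl.
  rewrite addnS /eqmodv -(subrK (u (N + k)%N) (u _)) -addrA.
  by apply: order_geD => //; apply: order_ge_leq (uS _); apply: leq_addr.
(* Coefficient [n] is frozen from stage [|n| + 1] on: congruence modulo [v ^ N] controls only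
   exponents strictly below [N]. *)
pose c (n : int) := coef (u `|n|.+1) n.
have c0 : exists m : nat, forall n : int, n < - m%:Z -> c n = 0.
  exists 0%N => n n0; apply: (eqmodv_order_ge (uD 0 _) u0); lia.
pose l := Laurent c0.
have ul : forall N, eqmodv N (u N) l.
  move=> N n nN; rewrite coefD coefN [coef l n]/= /c.
  apply/eqP; rewrite subr_eq0; apply/eqP.
  have [n0|n0] := ltP n 0.
    by rewrite !(eqmodv_order_ge (uD 0 _) u0).
  have /(_ n ltac:(lia)) := uD `|n|.+1 (N - `|n|.+1)%N.
  rewrite coefD coefN subnKC; last by lia.
  by move=> /eqP; rewrite subr_eq0 => /eqP.
by rewrite (llimE (eqmodv_lcvg ul)).
Qed.

(** [f] may have a pole of order up to [bound f]. Writing [f] as [v ^ (- bound f)] times a power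
    series costs [bound f] in the modulus, which the choice of the rank compensates. *)
Lemma lcvgMl f (u : nat -> laurent K) l : (forall N, eqmodv N (u N) l) ->
  lcvg (fun N => f * u N) (f * l).
Proof.
move=> ul n; exists (`|n| + bound f).+1 => N hN.
have fb : forall i : int, i < - (bound f)%:Z -> coef f i = 0.
  by rewrite /bound; case: boolp.cid.
have -> : f = lmono 1 (- (bound f)%:Z) * (lmono 1 (bound f)%:Z * f).
  by rewrite mulrA lmonoM addNr mulr1 lmono1 mul1r.
set g := lmono 1 (bound f)%:Z * f.
have g0 : order_ge 0 g.
  by move=> i i0; rewrite coef_lmonoM fb ?mulr0 //; lia.
rewrite -![_ * g * _]mulrA !coef_lmonoM !mul1r opprK.
have := order_geMl g0 (ul N); rewrite mulrBr => /(_ (n + bound f) ltac:(lia)).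
by rewrite coefD coefN => /eqP; rewrite subr_eq0 => /eqP.
Qed.

(** The symmetric partial sum of rank [N] reduces to [F 0 + ... + F N], the one-sided partial sum of
    rank [N + 1]. *)
Lemma lsumZ_nonneg (F : int -> laurent K) l :
  (forall n : nat, F (Negz n) = 0) ->
  lcvg (fun N => \sum_(0 <= n < N) F n%:Z) l -> lsumZ F = l.
Proof.
move=> F0 Fl; apply: llimE => n; have [N0 H] := Fl n.
exists N0 => N N0N; rewrite -(H N.+1); last by lia.
congr (coef _ n).
rewrite -(big_mkord xpredT (fun i => F (i%:Z - N%:Z))) (@big_cat_nat _ _ _ N) //=; last by lia.
rewrite [X in X + _]big_nat_cond big1 ?add0r; last first.
  move=> i /andP[/andP[_ iN] _].
  by rewrite (_ : i%:Z - N%:Z = Negz (N - i).-1) ?F0 //; lia.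
rewrite -{1}[N]add0n big_addn.
rewrite (_ : (N.*2.+1 - N)%N = N.+1); last by lia.
by apply: eq_bigr => i _; congr F; lia.
Qed.

End Order.

(* order_ge unfolds to a product mentioning its bound, so the n of statements
   such as order_ge n (v ^+ n) would otherwise become implicit. *)
Unset Implicit Arguments.

(** * Monomials in [v] and q-factorials *)

Lemma v_expzE (d : int) : v ^ d = lmono 1 d.
Proof.
have vn : forall n : nat, v ^+ n = lmono 1 n%:Z.
  elim=> [|n IH]; first by rewrite expr0 lmono1.
  by rewrite exprS IH lmonoM mulr1; congr lmono; lia.
case: d => n; first exact: vn.
rewrite NegzE -exprnN vn; apply: mulr1_eq.
by rewrite lmonoM subrr mulr1 lmono1.
Qed.

Lemma v_neq0 : v != 0.
Proof.
apply/eqP => v0; have := v_expzE 1; rewrite expr1z v0 => /(congr1 (fun f => coef f 1)).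
by rewrite coef0 coef_lmono eqxx => /eqP; rewrite eq_sym oner_eq0.
Qed.

Lemma order_ge_vX n : order_ge n (v ^+ n).
Proof. by rewrite (v_expzE n : v ^+ n = _); apply: order_ge_lmono. Qed.

Lemma signr_v_expz (k : nat) (d : int) : (-1) ^+ k * v ^ d = lmono ((-1) ^+ k) d.
Proof.
rewrite v_expzE; elim: k => [|k IH]; first by rewrite !expr0 mul1r.
rewrite exprS -mulrA IH mulN1r; apply: laurentP => n.
rewrite coefN !coef_lmono exprS mulN1r.
by case: eqP => _ //; rewrite oppr0.
Qed.

Lemma order_ge_qX n : order_ge n (q ^+ n).
Proof.
(* The true order in [v] is [2 * n]; the weaker bound keeps a single modulus throughout. *)
rewrite /q -exprM; apply: (@order_ge_leq _ _ (2 * n)); first by lia.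
exact: order_ge_vX.
Qed.

Lemma eqmodv_1BqX n : eqmodv n (1 - q ^+ n) 1.
Proof. by rewrite /eqmodv addrAC subrr sub0r; apply/order_geN/order_ge_qX. Qed.

Lemma unitary_1BqX n : unitary (1 - q ^+ n.+1).
Proof. exact: eqmodv_leq (eqmodv_1BqX n.+1). Qed.

Lemma unitary_1Bq : unitary (1 - q).
Proof. exact: (unitary_1BqX 0). Qed.

Lemma qpochS n : qpoch n.+1 = qpoch n * (1 - q ^+ n.+1).
Proof. by rewrite /qpoch big_nat_recr. Qed.

Lemma qpoch0 : qpoch 0 = 1.
Proof. by rewrite /qpoch big_geq. Qed.

Lemma unitary_qpoch n : unitary (qpoch n).
Proof.
elim: n => [|n IH]; first by rewrite qpoch0; apply: unitary1.
by rewrite qpochS; apply: unitaryM => //; apply: unitary_1BqX.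
Qed.

(** Consecutive partial products differ by the factor [1 - q ^+ n.+1], which is 1 modulo [v ^ n]. *)
Lemma eqmodv_qpoch_inf n : eqmodv n (qpoch n) qpoch_inf.
Proof.
apply: llim_eqmodv n => [|n]; first exact/unitary_ge0/unitary_qpoch.
rewrite qpochS -[X in eqmodv _ _ X]mulr1; apply: eqmodvM.
- exact/unitary_ge0/unitary_qpoch.
- exact: order_ge1.
- exact: eqmodv_refl.
- exact: eqmodv_leq (eqmodv_1BqX n.+1).
Qed.

Lemma unitary_qpoch_inf : unitary qpoch_inf.
Proof. exact: eqmodv_trans (eqmodv_sym (eqmodv_qpoch_inf 1)) (unitary_qpoch 1). Qed.

(** * Quantum multinomials as quotients of q-factorials *)

Lemma qint_field (F : fieldType) (x : F) n : x != 0 -> 1 - x ^+ 2 != 0 ->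
  (x ^+ n - x ^- n) / (x - x^-1) =
  x / x ^+ n * (1 - (x ^+ 2) ^+ n) / (1 - x ^+ 2).
Proof.
move=> x0 x1; have y0 : x ^+ n != 0 by rewrite expf_neq0.
have x2 : x ^+ 2 - 1 != 0 by rewrite -opprB oppr_eq0.
(* With [x ^+ n] replaced by an independent [y], the identity is a rational one in [x] and [y]. *)
rewrite -exprM mulnC exprM; move: (x ^+ n) y0 => y y0.
by field; rewrite x1 x0 y0 x2.
Qed.

Lemma qint_qpoch n : qint n = v ^ (1 - n%:Z) * (1 - q ^+ n) / (1 - q).
Proof.
rewrite /qint expfzDr ?v_neq0 // expr1z -exprnN qint_field ?v_neq0 //.
exact: unitary_neq0 unitary_1Bq.
Qed.

(** The exponents [1 - k] of the factors [qint k] add up to [- 'C(n, 2)]. *)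
Lemma qfact_qpoch n :
  qfact n = v ^ (- 'C(n, 2)%:Z) * qpoch n / (1 - q) ^+ n.
Proof.
have vn := v_neq0; have q1 := unitary_neq0 unitary_1Bq.
elim: n => [|n IH]; first by rewrite /qfact big_geq // qpoch0 expr0z expr0 divr1 mulr1.
rewrite /qfact big_nat_recr //= -/(qfact n) IH qint_qpoch qpochS.
rewrite (_ : - 'C(n.+1, 2)%:Z = - 'C(n, 2)%:Z + (1 - n.+1%:Z)); last first.
  by rewrite binS bin1; lia.
rewrite [v ^ (_ + (1 - _))]expfzDr // [(1 - q) ^+ n.+1]exprSr invfM.
by rewrite mulrACA [v ^ _ * _ * _]mulrACA.
Qed.

Lemma prod_qfact (s : seq nat) :
  \prod_(i <- s) qfact i =
  v ^ (- (\sum_(i <- s) 'C(i, 2))%:Z) * (\prod_(i <- s) qpoch i) /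
    (1 - q) ^+ sumn s.
Proof.
elim: s => [|i s IH]; first by rewrite !big_nil oppr0 expr0z !expr0 divr1 mulr1.
rewrite !big_cons IH qfact_qpoch /= exprD PoszD opprD expfzDr ?v_neq0 // invfM.
by rewrite (mulrACA (_ * qpoch i)) (mulrACA (v ^ _) (qpoch i)).
Qed.

(** The factor [qint (k + 1)] completes [qfact k] to [qfact k.+1]. As the entries sum to [k], the
    powers of [1 - q] cancel except for one. *)
Lemma qint_qmultinomial k (s : seq nat) : sumn s = k ->
  qint (k + 1) * qmultinomial k s =
  v ^ ((\sum_(i <- s) 'C(i, 2))%:Z - 'C(k.+1, 2)%:Z) *
    ((1 - q)^-1 * (qpoch k.+1 / \prod_(i <- s) qpoch i)).
Proof.
move=> sk; have q1 := unitary_neq0 unitary_1Bq.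
have -> : qint (k + 1) * qmultinomial k s = qfact k.+1 / \prod_(i <- s) qfact i.
  by rewrite /qmultinomial mulrA addn1 [in RHS]/qfact big_nat_recr //= [qint _ * _]mulrC.
rewrite prod_qfact qfact_qpoch sk expfzDr ?v_neq0 // exprS !invfM invrK invr_expz opprK.
set x := v ^ (- _); set y := v ^ _; set Q := (1 - q)^-1.
set X := (1 - q) ^+ k; set P := qpoch _; set R := (\prod_(_ <- _) _)^-1.
have XX : X^-1 * X = 1 by rewrite mulVf // expf_neq0.
transitivity (y * x * (Q * (P * R)) * (X^-1 * X)); last by rewrite XX mulr1.
clearbody x y Q X P R; ring.
Qed.

Lemma eqmodv_prod_qpoch N (s : seq nat) : (forall i, i \in s -> (N <= i)%N) ->
  eqmodv N (\prod_(i <- s) qpoch i) (qpoch_inf ^+ size s).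
Proof.
move=> sN; apply: eqmodv_prod => [|i /sN Ni]; first exact: unitary_qpoch_inf.
exact: eqmodv_leq (eqmodv_qpoch_inf i).
Qed.

Lemma unitary_prod_qpoch (s : seq nat) : unitary (\prod_(i <- s) qpoch i).
Proof. by apply: unitary_prod => i; apply: unitary_qpoch. Qed.

Lemma eqmodv_qpoch_ratio N k (s : seq nat) :
  (N <= k)%N -> (forall i, i \in s -> (N <= i)%N) ->
  eqmodv N (qpoch k / \prod_(i <- s) qpoch i)
           (qpoch_inf / qpoch_inf ^+ size s).
Proof.
move=> Nk Ns; have infu := unitary_qpoch_inf.
have infX := unitaryX (size s) infu.
apply: eqmodvM; [exact: unitary_ge0 | exact: order_geV | |].
  exact: eqmodv_leq (eqmodv_qpoch_inf k).
apply: eqmodvV => //; first exact: unitary_prod_qpoch.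
exact: eqmodv_prod_qpoch.
Qed.

(** * The limit for the Theta graph *)

Lemma Theta_lim a b c : admissible a b c ->
  lcvg (fun N => shifted (Theta (a + 2 * N) (b + 2 * N) (c + 2 * N)))
    ((1 - q)^-1 * (qpoch_inf ^+ 2)^-1).
Proof.
move=> /and4P[eabc abc bac cab]; apply: eqmodv_lcvg => N.
rewrite /Theta.
set k := ((a + 2 * N + (b + 2 * N) + (c + 2 * N))%N)./2; set s := [:: _; _; _].
(* Parity and the triangle inequalities make the halves and the subtractions exact. *)
have sk : sumn s = k by rewrite /s /k /=; lia.
have u1 : unitary (1 - q)^-1 by apply/unitaryV/unitary_1Bq.
rewrite -mulrA qint_qmultinomial // [(-1) ^+ k * _]mulrA signr_v_expz shifted_lmono ?signr_eq0 //; last first.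
  apply/unitaryM => //; apply/unitaryM; first exact: unitary_qpoch.
  exact/unitaryV/unitary_prod_qpoch.
have -> : (qpoch_inf ^+ 2)^-1 = qpoch_inf / qpoch_inf ^+ 3.
  by rewrite [_ ^+ 3]exprS [(_ * _ ^+ 2)^-1]invfM mulVKf // unitary_neq0 //; apply: unitary_qpoch_inf.
apply: eqmodvM; [exact: unitary_ge0 | | exact: eqmodv_refl |].
  apply: unitary_ge0; apply: unitaryM; first exact: unitary_qpoch_inf.
  exact/unitaryV/unitaryX/unitary_qpoch_inf.
(* The half sum [k] grows by [3 * N] and each of the three entries by [N], so all indices are at
   least [N]. *)
apply: (@eqmodv_qpoch_ratio _ _ s); first by rewrite /k; lia.
by move=> i; rewrite !inE => /or3P[] /eqP ->; lia.
Qed.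

(** * The series [J_FKB] as a one-sided sum *)

(** The summand of [J_FKB] at [n >= 0] without the constant monomial
    [v ^+ (s1 * s2 + s2 * s3 + s3 * s1)], so that the term at 0 has constant coefficient 1. *)
Definition fkb_term (s1 s2 s3 n : nat) : laurent rat :=
  (-1) ^+ n * v ^+ (n * (3 * n + 1) + 2 * n * (s1 + s2 + s3)) /
  \prod_(j <- [:: s1 + n; s2 + n; s3 + n]%N) qpoch j.

Definition fkb_sum (s1 s2 s3 : nat) : laurent rat :=
  llim (fun M => \sum_(0 <= n < M) fkb_term s1 s2 s3 n).

Lemma order_ge_fkb_term s1 s2 s3 n : order_ge n (fkb_term s1 s2 s3 n).
Proof.
rewrite /fkb_term -[n in order_ge n _]addn0; apply: order_geM.
  rewrite -[v ^+ _]/(v ^ _%:Z) signr_v_expz.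
  by apply: (order_ge_leq _ (@order_ge_lmono _ _ _)); nia.
exact/order_geV/unitary_prod_qpoch.
Qed.

Lemma eqmodv_fkb_sum s1 s2 s3 M :
  eqmodv M (\sum_(0 <= n < M) fkb_term s1 s2 s3 n) (fkb_sum s1 s2 s3).
Proof.
apply: (llim_eqmodv (u := fun M => \sum_(0 <= n < M) _)) => [|N].
  by rewrite big_geq //; apply: order_ge0.
by rewrite /eqmodv big_nat_recr //= addrAC subrr add0r; apply: order_ge_fkb_term.
Qed.

Lemma order_ge_fkb_sum s1 s2 s3 : order_ge 0 (fkb_sum s1 s2 s3).
Proof.
have := eqmodv_sym (eqmodv_fkb_sum s1 s2 s3 0).
by rewrite big_geq // /eqmodv subr0.
Qed.

(** Since some [s] is 0, for negative [n] the index [n + s] is negative and the corresponding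
    [qpochV] kills the summand. *)
Lemma J_FKB_sum (s1 s2 s3 : nat) : minn s1 (minn s2 s3) = 0%N ->
  J_FKB s1 s2 s3 =
  qpoch_inf * (v ^+ (s1 * s2 + s2 * s3 + s3 * s1) * fkb_sum s1 s2 s3).
Proof.
move=> smin; congr (_ * _); apply: lsumZ_nonneg => [n|].
  set Q := _ * qpochV _; suff -> : Q = 0 by rewrite mulr0.
  have V0 (s : nat) : s = 0%N -> qpochV (Negz n + s%:Z) = 0.
    by move=> ->; rewrite addr0.
  have : [|| s1 == 0%N, s2 == 0%N | s3 == 0%N] by lia.
  by rewrite /Q => /or3P[] /eqP /V0 ->; rewrite ?(mulr0, mul0r).
set G := (X in lcvg X _).
suff -> : G = fun N => v ^+ (s1 * s2 + s2 * s3 + s3 * s1) *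
                       \sum_(0 <= n < N) fkb_term s1 s2 s3 n.
  by apply: lcvgMl => N; apply: eqmodv_fkb_sum.
apply/boolp.funext => N; rewrite /G mulr_sumr; apply: eq_bigr => n _.
rewrite /fkb_term !big_cons big_nil mulr1 !invfM mulrA.
set e := (X in v ^ X).
have -> : e = (s1 * s2 + s2 * s3 + s3 * s1 +
               (n * (3 * n + 1) + 2 * n * (s1 + s2 + s3)))%N.
  by rewrite /e; lia.
rewrite -[v ^ _]/(v ^+ _) exprD -[(-1) ^ _]/((-1) ^+ n) -!PoszD /=.
by rewrite ![(n + _)%N]addnC; ring.
Qed.

(** * The summands of [Tet], counted down from the top index *)

(** The exponent of [v] given by [qint_qmultinomial] for these seven entries. *)
Definition tet_order (s1 s2 s3 t1 t2 t3 t4 : nat) : int :=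
  (\sum_(j <- [:: s1; s2; s3; t1; t2; t3; t4]) 'C(j, 2))%:Z -
  'C((s1 + s2 + s3 + t1 + t2 + t3 + t4).+1, 2)%:Z.

(** Lowering the summation index by [n] raises each [s] and lowers each [t] by [n]; adding [n] to
    the [t] on the other side avoids truncated subtraction. Once doubled, both sides are quadratic
    polynomials. *)
Lemma tet_orderB s1 s2 s3 t1 t2 t3 t4 n :
  tet_order (s1 + n) (s2 + n) (s3 + n) t1 t2 t3 t4 =
  tet_order s1 s2 s3 (t1 + n) (t2 + n) (t3 + n) (t4 + n) +
  (n * (3 * n + 1) + 2 * n * (s1 + s2 + s3))%N%:Z.
Proof.
(* The abstract c keeps binomial from being unfolded by simplification. *)
have [c cE] : exists c : nat -> int, forall m, c m = 'C(m, 2)%:Z.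
  by exists (fun m => 'C(m, 2)%:Z).
have c2 m : c m * 2 = m%:Z * (m%:Z - 1).
  by rewrite cE; elim: m => // m IH; rewrite binS bin1; nia.
have c2S m : c m.+1 * 2 = (m%:Z + 1) * m%:Z by rewrite c2; lia.
have E x1 x2 x3 y1 y2 y3 y4 : tet_order x1 x2 x3 y1 y2 y3 y4 =
    c x1 + c x2 + c x3 + c y1 + c y2 + c y3 + c y4
    - c (x1 + x2 + x3 + y1 + y2 + y3 + y4).+1.
  by rewrite /tet_order !big_cons big_nil !cE !addnA; lia.
apply: (@mulIf _ 2) => //; rewrite !E !mulrDl !mulNr !c2S !c2 !PoszD !PoszM !PoszD.
ring.
Qed.

Definition tet_ratio (k : nat) (t : seq nat) (n : nat) : laurent rat :=
  qpoch (k - n).+1 / \prod_(j <- [seq (j - n)%N | j <- t]) qpoch j.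

Lemma unitary_tet_ratio k t n : unitary (tet_ratio k t n).
Proof.
by apply: unitaryM; [apply: unitary_qpoch | apply/unitaryV/unitary_prod_qpoch].
Qed.

Lemma tet_term s1 s2 s3 t1 t2 t3 t4 n (k := (s1 + s2 + s3 + t1 + t2 + t3 + t4)%N) :
  (n <= t1)%N -> (n <= t2)%N -> (n <= t3)%N -> (n <= t4)%N ->
  (-1) ^+ (k - n) * qint (k - n + 1) *
    qmultinomial (k - n)
      [:: s1 + n; s2 + n; s3 + n; t1 - n; t2 - n; t3 - n; t4 - n]%N =
  (-1) ^+ k * v ^ tet_order s1 s2 s3 t1 t2 t3 t4 *
    ((1 - q)^-1 * (fkb_term s1 s2 s3 n * tet_ratio k [:: t1; t2; t3; t4] n)).
Proof.
move=> n1 n2 n3 n4; rewrite -mulrA qint_qmultinomial; last by rewrite /= /k; lia.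
(* As [n <= k], the sign [(-1) ^+ (k - n)] splits by parity into those of [k] and [n]. *)
rewrite -signr_odd oddB; last by rewrite /k; lia.
rewrite signr_addb !signr_odd.
set e := (X in v ^ X).
have -> : e = tet_order s1 s2 s3 t1 t2 t3 t4 +
              (n * (3 * n + 1) + 2 * n * (s1 + s2 + s3))%N%:Z.
  transitivity (tet_order (s1 + n) (s2 + n) (s3 + n) (t1 - n) (t2 - n) (t3 - n) (t4 - n)).
    rewrite /e /tet_order; congr (_ - 'C(_, 2)%:Z); rewrite /k; lia.
  by rewrite tet_orderB !subnK.
rewrite (expfzDr _ _ v_neq0) /fkb_term /tet_ratio [map _ _]/=.
rewrite -[[:: _, _, _ & _]]/([:: s1 + n; s2 + n; s3 + n]%N ++ [:: _; _; _; _]).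
rewrite big_cat /= invfM.
rewrite -[v ^+ (_ + _)]/(v ^ _%:Z).
move: (v ^ _) (v ^ _) (qpoch _) (_^-1) (_^-1) (_^-1) ((-1) ^+ _) ((-1) ^+ _) => *.
ring.
Qed.

(** Only the term [n = 0] reaches degree 0, and it has constant term 1; hence no cancellation occurs
    at lowest order. *)
Lemma unitary_tet_sum s1 s2 s3 k t M :
  unitary (\sum_(0 <= n < M.+1) fkb_term s1 s2 s3 n * tet_ratio k t n).
Proof.
rewrite big_nat_recl //= /unitary -[X in eqmodv _ _ X]addr0.
apply: eqmodvD.
  apply: unitaryM; last exact: unitary_tet_ratio.
  rewrite /fkb_term !muln0 !mul0n !expr0 !mul1r.
  exact/unitaryV/unitary_prod_qpoch.
rewrite /eqmodv subr0; apply: order_ge_sum => n _.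
apply: (@order_ge_leq _ _ (n.+1 + 0)%N) => //.
apply: order_geM; first exact: order_ge_fkb_term.
exact/unitary_ge0/unitary_tet_ratio.
Qed.

(** The ratio is known only modulo [v ^ (N - n)], but it multiplies a term of order at least [n], so
    the loss is made up. The omitted terms of [fkb_sum] have order above [M]. *)
Lemma eqmodv_tet_sum s1 s2 s3 k t M N :
  (N <= M)%N -> (N <= k)%N -> (forall j, j \in t -> (N <= j)%N) ->
  eqmodv N (\sum_(0 <= n < M.+1) fkb_term s1 s2 s3 n * tet_ratio k t n)
    (fkb_sum s1 s2 s3 * (qpoch_inf / qpoch_inf ^+ size t)).
Proof.
move=> NM Nk Nt; set r := qpoch_inf / _.
have r0 : order_ge 0 r.
  apply/unitary_ge0/unitaryM; first exact: unitary_qpoch_inf.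
  exact/unitaryV/unitaryX/unitary_qpoch_inf.
apply: (@eqmodv_trans _ _ _ (\sum_(0 <= n < M.+1) fkb_term s1 s2 s3 n * r)).
  rewrite /eqmodv -sumrB; apply: order_ge_sum => n _; rewrite -mulrBr.
  (* This also covers [n > N], where [N - n] is truncated to 0. *)
  apply: (@order_ge_leq _ _ (n + (N - n))%N); first by lia.
  apply: order_geM; first exact: order_ge_fkb_term.
  rewrite -/(eqmodv _ _ _) /r -(size_map (fun j => j - n)%N).
  apply: eqmodv_qpoch_ratio; first by lia.
  by move=> _ /mapP[j /Nt Nj ->]; lia.
rewrite -mulr_suml; apply: eqmodvM => //; last exact: eqmodv_refl.
  exact: order_ge_fkb_sum.
by apply: (@eqmodv_leq _ _ M.+1); [lia | apply: eqmodv_fkb_sum].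
Qed.

Lemma sum_nat_down (V : nmodType) (F : nat -> V) (m n : nat) : (m <= n)%N ->
  \sum_(m <= k < n.+1) F k = \sum_(0 <= i < (n - m).+1) F (n - i)%N.
Proof.
move=> mn; rewrite big_nat_rev /= -{1}[m]add0n big_addn subSn //.
by apply: eq_bigr => i _; congr F; lia.
Qed.

(** The balance of the [S] and the [T] says that the seven entries at [k = Smin] sum to [Smin], as
    [tet_term] requires. The exponent [d] is existential because [shifted] erases it. *)
Lemma tet_sumE S1 S2 S3 T1 T2 T3 T4 Smin Tmax :
  (S1 + S2 + S3 = T1 + T2 + T3 + T4)%N -> (Tmax <= Smin)%N ->
  [&& Smin <= S1, Smin <= S2 & Smin <= S3]%N ->
  [&& T1 <= Tmax, T2 <= Tmax, T3 <= Tmax & T4 <= Tmax]%N ->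
  exists d : int,
  \sum_(Tmax <= k < Smin.+1)
    (-1) ^+ k * qint (k + 1) *
    qmultinomial k
      [:: S1 - k; S2 - k; S3 - k; k - T1; k - T2; k - T3; k - T4]%N =
  (-1) ^+ Smin * v ^ d *
    ((1 - q)^-1 * \sum_(0 <= n < (Smin - Tmax).+1)
       fkb_term (S1 - Smin) (S2 - Smin) (S3 - Smin) n *
       tet_ratio Smin [:: Smin - T1; Smin - T2; Smin - T3; Smin - T4]%N n).
Proof.
move=> ST TS /and3P[s1 s2 s3] /and4P[t1 t2 t3 t4]; rewrite sum_nat_down //.
exists (tet_order (S1 - Smin) (S2 - Smin) (S3 - Smin)
         (Smin - T1) (Smin - T2) (Smin - T3) (Smin - T4)).
rewrite mulr_sumr mulr_sumr; apply: eq_big_nat => n /andP[_ nM].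
have Es : (S1 - Smin + (S2 - Smin) + (S3 - Smin) + (Smin - T1) + (Smin - T2) +
           (Smin - T3) + (Smin - T4))%N = Smin by lia.
have := @tet_term (S1 - Smin) (S2 - Smin) (S3 - Smin)
  (Smin - T1) (Smin - T2) (Smin - T3) (Smin - T4) n.
rewrite /= Es => <-; try lia.
rewrite ![(Smin - n - _)%N]subnAC.
have e S : (Smin <= S)%N -> (S - (Smin - n) = S - Smin + n)%N by lia.
by rewrite !e.
Qed.

(** * The limit for the tetrahedron graph *)

Lemma Tet_lim a b c d e f : admissible_tet a b c d e f ->
  let S1 := (a + d + b + c)./2 in
  let S2 := (a + d + e + f)./2 in
  let S3 := (b + c + e + f)./2 in
  let Smin := minn S1 (minn S2 S3) in
  lcvg (fun N => shifted (Tet (a + 2 * N) (b + 2 * N) (e + 2 * N)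
                              (d + 2 * N) (c + 2 * N) (f + 2 * N)))
    ((1 - q)^-1 * (fkb_sum (S1 - Smin) (S2 - Smin) (S3 - Smin) *
                   (qpoch_inf / qpoch_inf ^+ 4))).
Proof.
move=> /and4P[/and4P[p1 p2 p3 p4] /and4P[p5 p6 p7 p8]
  /and4P[p9 p10 p11 p12] /and4P[p13 p14 p15 p16]] S1 S2 S3 Smin.
pose T1 := (a + b + e)./2; pose T2 := (a + c + f)./2.
pose T3 := (c + d + e)./2; pose T4 := (b + d + f)./2.
pose Tmax := maxn T1 (maxn T2 (maxn T3 T4)).
have ST : (S1 + S2 + S3 = T1 + T2 + T3 + T4)%N.
  by rewrite /S1 /S2 /S3 /T1 /T2 /T3 /T4; lia.
have TS : (Tmax <= Smin)%N.
  (* Each [S_i - T_j] is half the excess in one triangle inequality; for instance [S1 - T1] is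
     [(c + d - e) / 2]. *)
  by rewrite !geq_max !leq_min !half_leq //; lia.
have [Ss Ts] : [&& Smin <= S1, Smin <= S2 & Smin <= S3]%N /\
               [&& T1 <= Tmax, T2 <= Tmax, T3 <= Tmax & T4 <= Tmax]%N.
  by rewrite !geq_min !leq_max !leqnn !orbT.
apply: eqmodv_lcvg => N; rewrite /Tet.
(* Each [S] grows by [4 * N] and each [T] by [3 * N]: the [S_i - Smin] stay fixed while the
   [Smin - T_j] grow by [N]. *)
have -> : ((a + 2 * N + (d + 2 * N) + (b + 2 * N) + (c + 2 * N))./2 = S1 + 4 * N)%N.
  by rewrite /S1; lia.
have -> : ((a + 2 * N + (d + 2 * N) + (e + 2 * N) + (f + 2 * N))./2 = S2 + 4 * N)%N.
  by rewrite /S2; lia.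
have -> : ((b + 2 * N + (c + 2 * N) + (e + 2 * N) + (f + 2 * N))./2 = S3 + 4 * N)%N.
  by rewrite /S3; lia.
have -> : ((a + 2 * N + (b + 2 * N) + (e + 2 * N))./2 = T1 + 3 * N)%N.
  by rewrite /T1; lia.
have -> : ((a + 2 * N + (c + 2 * N) + (f + 2 * N))./2 = T2 + 3 * N)%N.
  by rewrite /T2; lia.
have -> : ((c + 2 * N + (d + 2 * N) + (e + 2 * N))./2 = T3 + 3 * N)%N.
  by rewrite /T3; lia.
have -> : ((b + 2 * N + (d + 2 * N) + (f + 2 * N))./2 = T4 + 3 * N)%N.
  by rewrite /T4; lia.
rewrite -!addn_minl -!addn_maxl -/Smin -/Tmax.
clearbody Tmax Smin T1 T2 T3 T4 S1 S2 S3.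
have [||||z ->] := @tet_sumE (S1 + 4 * N) (S2 + 4 * N) (S3 + 4 * N)
    (T1 + 3 * N) (T2 + 3 * N) (T3 + 3 * N) (T4 + 3 * N)
    (Smin + 4 * N) (Tmax + 3 * N); rewrite ?leq_add2r //; try lia.
rewrite signr_v_expz !subnDr shifted_lmono ?signr_eq0 //; last first.
  apply: unitaryM; last exact: unitary_tet_sum.
  exact/unitaryV/unitary_1Bq.
have fu := unitary_qpoch_inf.
move: Ss Ts => /and3P[s1 s2 s3] /and4P[t1 t2 t3 t4].
apply: eqmodvM; [exact/unitary_ge0/unitaryV/unitary_1Bq | | exact: eqmodv_refl |].
  apply: (@order_geM _ 0 0); first exact: order_ge_fkb_sum.
  exact/unitary_ge0/unitaryM/unitaryV/unitaryX.
apply: (@eqmodv_tet_sum _ _ _ _ [:: _; _; _; _]); try lia.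
by move=> j; rewrite !inE => /or4P[] /eqP ->; lia.
Qed.

(* The factor (-1) ^ nu in front of (- v^-1) ^ nu is a sign correction: a
   shifted series has leading coefficient 1, and so has J_FKB s1 s2 s3 (the
   smallest of its arguments is 0), so the limit involves q ^ (- nu / 2) rather
   than (- q ^ (- 1 / 2)) ^ nu. *)
Theorem proposition1p2 :
  (forall a b c : nat, admissible a b c ->
     lcvg (fun N => shifted (Theta (a + 2 * N) (b + 2 * N) (c + 2 * N)))
       ((1 - q)^-1 * (qpoch_inf ^+ 2)^-1)) /\
  (forall a b c d e f : nat, admissible_tet a b c d e f ->
     let S1 := (a + d + b + c)./2 in
     let S2 := (a + d + e + f)./2 in
     let S3 := (b + c + e + f)./2 in
     let Smin := minn S1 (minn S2 S3) in
     let s1 : int := (S1 - Smin)%N in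
     let s2 : int := (S2 - Smin)%N in
     let s3 : int := (S3 - Smin)%N in
     lcvg (fun N => shifted (Tet (a + 2 * N) (b + 2 * N) (e + 2 * N)
                                 (d + 2 * N) (c + 2 * N) (f + 2 * N)))
       ((-1) ^ nu s1 s2 s3 *
        ((- v^-1) ^ nu s1 s2 s3 *
         ((1 - q) * qpoch_inf ^+ 4)^-1 * J_FKB s1 s2 s3))).
Proof.
split=> [a b c|a b c d e f adm S1 S2 S3 Smin s1 s2 s3]; first exact: Theta_lim.
set l := (X in lcvg _ X).
suff -> : l = (1 - q)^-1 * (fkb_sum (S1 - Smin) (S2 - Smin) (S3 - Smin) *
                            (qpoch_inf / qpoch_inf ^+ 4)) by exact: Tet_lim.
have smin : minn (S1 - Smin) (minn (S2 - Smin) (S3 - Smin)) = 0%N.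
  by rewrite /Smin; move: S1 S2 S3 {Smin s1 s2 s3 l} => x y z; lia.
rewrite /l J_FKB_sum // /s1 /s2 /s3.
move: smin; move: (S1 - Smin)%N (S2 - Smin)%N (S3 - Smin)%N => x y z smin.
(* The smallest of [x], [y], [z] is 0, so [nu] is the exponent of the monomial that [J_FKB_sum]
   splits off. *)
set w := (x * y + y * z + z * x)%N.
have -> : nu x y z = w%:Z.
  have xyz : Num.min x%:Z (Num.min y%:Z z%:Z) = 0 by lia.
  by rewrite /nu xyz !subr0 /w; lia.
have vw : v ^+ w != 0 by rewrite expf_neq0 ?v_neq0.
(* The two signed powers multiply to [v ^- w], which cancels that monomial. *)
rewrite -![_ ^ w%:Z]/(_ ^+ w) -mulrA mulrA -exprMn mulN1r opprK exprVn.
rewrite [qpoch_inf * (_ * _)]mulrCA [(_ * _)^-1 * (_ * _)]mulrCA mulKf // invfM.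
move: (fkb_sum _ _ _) qpoch_inf (1 - q)^-1 ((qpoch_inf ^+ 4)^-1) => *.
ring.
Qed.
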